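(* Let $0<q<1$, $k\in\mathbb{N}_0$, $0\le\mu\le 1$, and let $f(z)=z+\sum_{n=2}^{\infty}a_nz^n$ be in the class $\mathcal{F}\Sigma_q^{k}(\mu,\phi)$. Then $$|a_2|\le\frac{B_1\sqrt{B_1}}{\sqrt{\left|(1+2\mu)[3]_q^{k}B_1^2+(1+\mu)^2[2]_q^{2k}(B_1-B_2)\right|}}$$ and $$|a_3|\le B_1\left(\frac{B_1}{(1+\mu)^2[2]_q^{2k}}+\frac{1}{(1+2\mu)[3]_q^{k}}\right).$$
   Context: Let $\Delta=\{z\in\mathbb{C}:|z|<1\}$ and let $\mathcal{A}$ be the class of analytic functions on $\Delta$ of the form $f(z)=z+\sum_{n=2}^\infty a_nz^n$. A function $f\in\mathcal{A}$ is bi-univalent if both $f$ and $f^{-1}$ are univalent in $\Delta$ (that is, $f$ is univalent in $\Delta$ and its inverse, defined near $0$, extends to a univalent analytic function $g=f^{-1}$ on $\Delta$); $\Sigma$ denotes the class of bi-univalent functions. The inverse has the expansion $g(w)=w-a_2w^2+(2a_2^2-a_3)w^3+\cdots$. Subordination: for analytic $F,G$ on $\Delta$, $F\prec G$ means that there is an analytic $\omega$ on $\Delta$ with $\omega(0)=0$, $|\omega(z)|<1$ and $F(z)=G(\omega(z))$ for $z \in\Delta$. The function $\phi$ is analytic with positive real part in $\Delta$, $\phi(0)=1$, $\phi'(0)>0$, maps $\Delta$ onto a region starlike with respect to $1$ and symmetric with respect to the real axis, and has the expansion $\phi(z)=1+B_1z+B_2z^2+B_3z^3+\cdots$ with $B_1>0$.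 For $0<q<1$, $[n]_q=\frac{1-q^n}{1-q}$; $[n]_q^{k}$ means $([n]_q)^k$. The Sălăgean $q$-differential operator is, for $k\in\mathbb{N}_0=\{0,1,2,\dots\}$ and $h(z)=z+\sum_{n\ge2}c_nz^n$, $\mathcal{D}_q^k h(z)=z+\sum_{n=2}^\infty [n]_q^k c_nz^n$. Class $\mathcal{F}\Sigma_q^{k}(\mu,\phi)$: the set of $f\in\Sigma$ such that, with $g=f^{-1}$, $$(1-\mu)\frac{\mathcal{D}_q^{k}f(z)}{z}+\mu\,(\mathcal{D}_q^{k}f(z))'\prec\phi(z)\quad\text{and}\quad(1-\mu)\frac{\mathcal{D}_q^{k}g(w)}{w}+\mu\,(\mathcal{D}_q^{k}g(w))'\prec\phi(w)$$ for $z,w\in\Delta$, where $'$ is the ordinary derivative (the quotients take the value $1$ at the origin). *)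

(* Defs.v *)
From Stdlib Require Import Reals.
From Coquelicot Require Import Coquelicot.
Open Scope R_scope.

Definition disc (z : C) : Prop := Cmod z < 1.

(* Local representability by power series around every point. *)
Definition analytic_on (D : C -> Prop) (F : C -> C) : Prop :=
  forall z0 : C, D z0 ->
  exists (c : nat -> C) (r : R), 0 < r /\
    forall z : C, Cmod (z - z0)%C < r -> is_pseries c (z - z0)%C (F z).

Definition expansion_on_disc (F : C -> C) (c : nat -> C) : Prop :=
  forall z : C, disc z -> is_pseries c z (F z).

Definition normalized_expansion (h : C -> C) (c : nat -> C) : Prop :=
  c 0%nat = RtoC 0 /\ c 1%nat = RtoC 1 /\ expansion_on_disc h c.

Definition class_A (f : C -> C) : Prop :=
  analytic_on disc f /\ exists a : nat -> C, normalized_expansion f a.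

Definition univalent_on (D : C -> Prop) (f : C -> C) : Prop :=
  analytic_on D f /\
  forall z1 z2 : C, D z1 -> D z2 -> f z1 = f z2 -> z1 = z2.

(* [g] coincides near 0 with the inverse of [f] on the disc; when [f] is
   injective on the disc, the point [g w] below is determined by [w]. *)
Definition local_inverse (f g : C -> C) : Prop :=
  exists r : R, 0 < r /\
    forall w : C, Cmod w < r -> disc (g w) /\ f (g w) = w.

(* [f] is bi-univalent, [g] being the extension of its inverse to the disc. *)
Definition bi_univalent_with (f g : C -> C) : Prop :=
  class_A f /\ univalent_on disc f /\ univalent_on disc g /\ local_inverse f g.

Definition subordinate (F G : C -> C) : Prop :=
  exists omega : C -> C,
    analytic_on disc omega /\ omega (RtoC 0) = RtoC 0 /\
    forall z : C, disc z -> Cmod (omega z) < 1 /\ F z = G (omega z).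

Definition image_of_disc (F : C -> C) (w : C) : Prop :=
  exists z : C, disc z /\ F z = w.

Definition starlike_wrt (p : C) (S : C -> Prop) : Prop :=
  forall (w : C) (t : R), S w -> 0 <= t <= 1 ->
    S (p + RtoC t * (w - p))%C.

Definition real_axis_symmetric (S : C -> Prop) : Prop :=
  forall w : C, S w -> S (Cconj w).

Definition ma_minda (phi : C -> C) : Prop :=
  analytic_on disc phi /\
  (forall z : C, disc z -> 0 < Re (phi z)) /\
  phi (RtoC 0) = RtoC 1 /\
  (exists d : R, 0 < d /\ is_derive phi (RtoC 0) (RtoC d)) /\
  starlike_wrt (RtoC 1) (image_of_disc phi) /\
  real_axis_symmetric (image_of_disc phi).

Definition qnum (q : R) (n : nat) : R := (1 - q ^ n) / (1 - q).

(* [Dh] is D_q^k h on the disc. The 0-th term vanishes because [c 0 = 0]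
   (for k = 0 the factor is [0 ^ 0 = 1]), and [qnum q 1 = 1]. *)
Definition salagean (q : R) (k : nat) (h Dh : C -> C) : Prop :=
  exists c : nat -> C, normalized_expansion h c /\
    expansion_on_disc Dh (fun n => (RtoC (qnum q n ^ k) * c n)%C).

(* (1 - mu) H(z)/z + mu H'(z), the quotient being 1 at the origin. *)
Definition mu_transform (mu : R) (H : C -> C) (z : C) : C :=
  (RtoC (1 - mu) * (if Ceq_dec z (RtoC 0) then RtoC 1 else H z / z)
   + RtoC mu * C_derive H z)%C.

Definition class_FSigma (q : R) (k : nat) (mu : R) (phi f : C -> C) : Prop :=
  exists g Df Dg : C -> C,
    bi_univalent_with f g /\
    salagean q k f Df /\ salagean q k g Dg /\
    subordinate (mu_transform mu Df) phi /\
    subordinate (mu_transform mu Dg) phi.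

(* Main.v *)
Require Import Defs.
From Stdlib Require Import Reals Lra Classical ClassicalEpsilon.
From Coquelicot Require Import Coquelicot.
Open Scope R_scope.

(** Write [P = (1 + 2 mu) [3]_q^k] and [s = (1 + mu) [2]_q^k].  The transform
    of [f] is [1 + s a2 z + P a3 z^2 + O(z^3)], and that of the inverse [g] is
    the same with [-a2] and [2 a2^2 - a3] in place of [a2] and [a3].  If
    these are [phi o u] and [phi o v] with Schwarz functions
    [u = c1 z + c2 z^2 + ...] and [v = d1 z + d2 z^2 + ...], comparing
    coefficients gives
      [s a2 = B1 c1],          [P a3 = B1 c2 + B2 c1^2],
      [- s a2 = B1 d1],        [P (2 a2^2 - a3) = B1 d2 + B2 d1^2].
    Hence [d1 = - c1], and elimination yields
      [a2^2 (P B1^2 + s^2 (B1 - B2)) = B1^3 ((c2 + d2) / 2 + c1^2)],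
      [a3 = a2^2 + B1 (c2 - d2) / (2 P)].
    Both bounds follow from [|c1| <= 1], [|c2 - d2| <= 2] and
    [|(c2 + d2) / 2 + c1^2| <= 1].

    Each of these three is a single instance of Schwarz's lemma for a function
    with a double zero ([schwarz_coefficient]: a function bounded by 1 on the
    disc and equal to [A z^2 + O(z^3)] at 0 has [|A| <= 1]).  It is applied to
    [u^2], to [(u(z) - v(-z)) / 2], and to [(u + v - 2 u v) / (2 - u - v)]; the
    last is the Cayley transform of the mean of the functions of positive real
    part [(1 + u) / (1 - u)] and [(1 + v) / (1 - v)].

    Analyticity enters only through second-order Taylor expansions with a
    cubic remainder at each point ([jet]).  These are stable under
    sums, products, inverses and composition, and they suffice for the maximum
    principle: averaging over the four directions [x], [-x], [ix], [-ix] shows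
    that [|h|^2 + eps |z|^2] has no interior maximum.  The singularity of
    [F / z^2] at 0 is bypassed by applying the maximum principle to
    [z (F / z^2)^n] and letting [n] grow ([schwarz_order_2]). *)

(** * Behaviour near the origin *)

Definition near0 (P : C -> Prop) : Prop :=
  exists r : R, 0 < r /\ forall t : C, Cmod t < r -> P t.

Lemma near0_and (P Q : C -> Prop) :
  near0 P -> near0 Q -> near0 (fun t => P t /\ Q t).
Proof.
intros [r [Hr HP]] [s [Hs HQ]].
exists (Rmin r s); split; [now apply Rmin_pos |].
intros t Ht; split.
- apply HP; apply Rlt_le_trans with (1 := Ht); apply Rmin_l.
- apply HQ; apply Rlt_le_trans with (1 := Ht); apply Rmin_r.
Qed.

Lemma near0_imp (P Q : C -> Prop) :
  (forall t, P t -> Q t) -> near0 P -> near0 Q.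
Proof. intros H [r [Hr HP]]; exists r; auto. Qed.

Lemma near0_all (P : C -> Prop) : (forall t, P t) -> near0 P.
Proof. intros H; exists 1; split; [lra | auto]. Qed.

Lemma near0_at0 (P : C -> Prop) : near0 P -> P 0%C.
Proof. intros [r [Hr H]]; apply H; now rewrite Cmod_0. Qed.

Definition bounded0 (e : C -> C) : Prop :=
  exists K : R, 0 <= K /\ near0 (fun t => Cmod (e t) <= K).

Lemma bounded0_const (c : C) : bounded0 (fun _ => c).
Proof.
exists (Cmod c); split; [apply Cmod_ge_0 |].
apply near0_all; intros _; apply Rle_refl.
Qed.

Lemma bounded0_id : bounded0 (fun t => t).
Proof. exists 1; split; [lra |]; exists 1; split; intros; lra. Qed.

Lemma bounded0_plus (e1 e2 : C -> C) :
  bounded0 e1 -> bounded0 e2 -> bounded0 (fun t => e1 t + e2 t)%C.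
Proof.
intros [K [HK H1]] [L [HL H2]]; exists (K + L); split; [lra |].
apply near0_imp with (2 := near0_and _ _ H1 H2); intros t [A B].
apply Rle_trans with (1 := Cmod_triangle _ _); lra.
Qed.

Lemma bounded0_mult (e1 e2 : C -> C) :
  bounded0 e1 -> bounded0 e2 -> bounded0 (fun t => e1 t * e2 t)%C.
Proof.
intros [K [HK H1]] [L [HL H2]]; exists (K * L); split.
  now apply Rmult_le_pos.
apply near0_imp with (2 := near0_and _ _ H1 H2); intros t [A B].
rewrite Cmod_mult; apply Rmult_le_compat; auto using Cmod_ge_0.
Qed.

(** A bounded [s] makes [t s(t)] tend to 0: inner functions of compositions are
    written in this form. *)
Lemma near0_comp (P : C -> Prop) (s : C -> C) :
  near0 P -> bounded0 s -> near0 (fun t => P (t * s t)%C).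
Proof.
intros [r [Hr HP]] [K [HK Hs]].
assert (H : near0 (fun t => Cmod t < r / (K + 1))).
  exists (r / (K + 1)); split; [apply Rdiv_lt_0_compat; lra | auto].
apply near0_imp with (2 := near0_and _ _ Hs H); intros t [A B].
apply HP; rewrite Cmod_mult.
assert (E : r / (K + 1) * (K + 1) = r) by (field; lra).
pose proof (Cmod_ge_0 t); pose proof (Cmod_ge_0 (s t)).
nra.
Qed.

Lemma bounded0_comp (e s : C -> C) :
  bounded0 e -> bounded0 s -> bounded0 (fun t => e (t * s t)%C).
Proof.
intros [K [HK He]] Hs; exists K; split; auto.
exact (near0_comp _ _ He Hs).
Qed.

Lemma bounded0_inv_shift (c : C) :
  c <> 0%C ->
  near0 (fun t => (c + t)%C <> 0%C) /\ bounded0 (fun t => / (c + t))%C.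
Proof.
intros Hc; apply Cmod_gt_0 in Hc.
assert (H : forall t, Cmod t < Cmod c / 2 -> Cmod c / 2 <= Cmod (c + t)).
  intros t Ht.
  pose proof (Cmod_triangle (c + t) (- t)) as T.
  replace (c + t + - t)%C with c in T by ring.
  rewrite Cmod_opp in T; lra.
assert (N : forall t, Cmod t < Cmod c / 2 -> (c + t)%C <> 0%C).
  intros t Ht; apply Cmod_gt_0; specialize (H t Ht); lra.
split.
- exists (Cmod c / 2); split; [lra | auto].
- exists (/ (Cmod c / 2)); split.
    left; apply Rinv_0_lt_compat; lra.
  exists (Cmod c / 2); split; [lra |]; intros t Ht.
  rewrite Cmod_inv by auto.
  apply Rinv_le_contravar; [lra | auto].
Qed.

(** Dividing a vanishing expansion by [t] leaves this form, valid off 0 only;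
    letting [t] tend to 0 kills the next coefficient. *)
Lemma coefficient_zero (a : C) (e : C -> C) :
  bounded0 e -> near0 (fun t => t <> 0%C -> (a + t * e t)%C = 0%C) -> a = 0%C.
Proof.
intros [K [HK He]] H.
destruct (near0_and _ _ He H) as [r [Hr Hb]].
apply NNPP; intros Ha; apply Cmod_gt_0 in Ha.
set (x := Rmin (r / 2) (Cmod a / (2 * (K + 1)))).
assert (Hx : 0 < x).
  apply Rmin_pos; [lra |]; apply Rdiv_lt_0_compat; lra.
assert (Hx1 : x <= r / 2) by apply Rmin_l.
assert (Hx2 : x <= Cmod a / (2 * (K + 1))) by apply Rmin_r.
assert (Hm : Cmod (RtoC x) = x) by (rewrite Cmod_R; apply Rabs_pos_eq; lra).
destruct (Hb (RtoC x)) as [E1 E2]; [rewrite Hm; lra |].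
assert (E3 : (a + x * e x)%C = 0%C).
  apply E2; intros E; rewrite E, Cmod_0 in Hm; lra.
assert (E4 : a = (- (x * e x))%C).
  replace a with (a + x * e x - x * e x)%C by ring; rewrite E3; ring.
apply (f_equal Cmod) in E4; rewrite Cmod_opp, Cmod_mult, Hm in E4.
assert (E5 : Cmod a / (2 * (K + 1)) * (2 * (K + 1)) = Cmod a) by (field; lra).
nra.
Qed.

(** * Second-order expansions *)

(** The remainder is given as [t^3 e(t)] rather than by an inequality, so that
    stability under the operations becomes a ring identity exhibiting the new
    [e], plus the closure properties of [bounded0]. *)
Definition jet (h : C -> C) (z c0 c1 c2 : C) : Prop :=
  exists e : C -> C, bounded0 e /\
    near0 (fun t => h (z + t)%C = (c0 + c1 * t + c2 * t ^ 2 + t ^ 3 * e t)%C).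

Ltac bounded0_tac :=
  repeat first
    [ assumption | apply bounded0_const | apply bounded0_id
    | apply bounded0_plus | apply bounded0_mult ].

Lemma jet_eq_coef (h : C -> C) (z c0 c1 c2 d0 d1 d2 : C) :
  jet h z c0 c1 c2 -> c0 = d0 -> c1 = d1 -> c2 = d2 -> jet h z d0 d1 d2.
Proof. now intros H -> -> ->. Qed.

Lemma jet_ext (h k : C -> C) (z c0 c1 c2 : C) :
  near0 (fun t => h (z + t)%C = k (z + t)%C) ->
  jet h z c0 c1 c2 -> jet k z c0 c1 c2.
Proof.
intros E [e [He H]]; exists e; split; auto.
apply near0_imp with (2 := near0_and _ _ E H); intros t [A B].
now rewrite <- A.
Qed.

Lemma jet_value (h : C -> C) (z c0 c1 c2 : C) : jet h z c0 c1 c2 -> h z = c0.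
Proof.
intros [e [_ H]]; apply near0_at0 in H.
replace (z + 0)%C with z in H by ring; rewrite H; ring.
Qed.

(** The constant terms are both the value at the point; the other two
    coefficients are compared after dividing the difference by [t] and then
    by [t^2]. *)
Lemma jet_unique (h : C -> C) (z c0 c1 c2 d0 d1 d2 : C) :
  jet h z c0 c1 c2 -> jet h z d0 d1 d2 -> c0 = d0 /\ c1 = d1 /\ c2 = d2.
Proof.
intros Hc Hd.
assert (E0 : c0 = d0).
  now rewrite <- (jet_value _ _ _ _ _ Hc), <- (jet_value _ _ _ _ _ Hd).
destruct Hc as [e [He Hc]], Hd as [f [Hf Hd]].
assert (H := near0_and _ _ Hc Hd).
assert (E1 : (c1 - d1)%C = 0%C).
  apply coefficient_zero
    with (e := fun t => (c2 + - d2 + t * (e t + (- (1)) * f t))%C).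
    bounded0_tac.
  apply near0_imp with (2 := H); intros t [A B] Ht.
  rewrite A, E0 in B.
  assert (E : (t * (c1 - d1 + t * (c2 + - d2 + t * (e t + (- (1)) * f t))))%C
              = 0%C).
    match type of B with ?l = ?r =>
      replace (RtoC 0) with (l - r)%C by (rewrite B; ring) end.
    ring.
  apply NNPP; intros N; now apply (Cmult_neq_0 _ _ Ht N).
assert (F1 : c1 = d1).
  replace c1 with (c1 - d1 + d1)%C by ring; rewrite E1; ring.
assert (E2 : (c2 - d2)%C = 0%C).
  apply coefficient_zero with (e := fun t => (e t + (- (1)) * f t)%C).
    bounded0_tac.
  apply near0_imp with (2 := H); intros t [A B] Ht.
  rewrite A, E0, F1 in B.
  assert (E : (t * (t * (c2 - d2 + t * (e t + (- (1)) * f t))))%C = 0%C).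
    match type of B with ?l = ?r =>
      replace (RtoC 0) with (l - r)%C by (rewrite B; ring) end.
    ring.
  apply NNPP; intros N.
  now apply (Cmult_neq_0 _ _ Ht (Cmult_neq_0 _ _ Ht N)).
split; [| split]; auto.
replace c2 with (c2 - d2 + d2)%C by ring; rewrite E2; ring.
Qed.

Lemma jet_const (c z : C) : jet (fun _ => c) z c 0 0.
Proof.
exists (fun _ => 0%C); split; [bounded0_tac |].
apply near0_all; intros t; ring.
Qed.

Lemma jet_id (z : C) : jet (fun w => w) z z 1 0.
Proof.
exists (fun _ => 0%C); split; [bounded0_tac |].
apply near0_all; intros t; ring.
Qed.

Lemma jet_plus (h k : C -> C) (z c0 c1 c2 d0 d1 d2 : C) :
  jet h z c0 c1 c2 -> jet k z d0 d1 d2 ->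
  jet (fun w => h w + k w)%C z (c0 + d0) (c1 + d1) (c2 + d2).
Proof.
intros [e [He H]] [f [Hf K]].
exists (fun t => e t + f t)%C; split; [bounded0_tac |].
apply near0_imp with (2 := near0_and _ _ H K); intros t [A B].
rewrite A, B; ring.
Qed.

Lemma jet_mult (h k : C -> C) (z c0 c1 c2 d0 d1 d2 : C) :
  jet h z c0 c1 c2 -> jet k z d0 d1 d2 ->
  jet (fun w => h w * k w)%C z
    (c0 * d0) (c0 * d1 + c1 * d0) (c0 * d2 + c1 * d1 + c2 * d0).
Proof.
intros [e [He H]] [f [Hf K]].
exists (fun t => (c1 * d2 + c2 * d1) + (c2 * d2) * t
   + e t * (d0 + d1 * t + d2 * (t * t))
   + f t * (c0 + c1 * t + c2 * (t * t)) + (t * (t * t)) * (e t * f t))%C.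
split; [bounded0_tac |].
apply near0_imp with (2 := near0_and _ _ H K); intros t [A B].
rewrite A, B; ring.
Qed.

Lemma jet_comp (h k : C -> C) (z c0 c1 c2 d0 d1 d2 : C) :
  jet k z d0 d1 d2 -> jet h d0 c0 c1 c2 ->
  jet (fun w => h (k w)) z c0 (c1 * d1) (c1 * d2 + c2 * d1 ^ 2).
Proof.
intros [f [Hf K]] [e [He H]].
set (s := fun t => (d1 + d2 * t + (t * t) * f t)%C).
assert (Hs : bounded0 s) by (unfold s; bounded0_tac).
exists (fun t => c1 * f t + c2 * (d2 + t * f t) * (d1 + s t)
   + (s t * (s t * s t)) * e (t * s t))%C.
split.
  bounded0_tac; now apply bounded0_comp.
apply near0_imp with (2 := near0_and _ _ (near0_comp _ _ H Hs) K).
intros t [A B].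
rewrite B.
replace (d0 + d1 * t + d2 * t ^ 2 + t ^ 3 * f t)%C with (d0 + t * s t)%C
  by (unfold s; ring).
rewrite A; generalize (e (t * s t)%C); intros x; unfold s; ring.
Qed.

Lemma jet_inv (z : C) :
  z <> 0%C -> jet Cinv z (/ z) (- / z ^ 2) (/ z ^ 3).
Proof.
intros Hz.
destruct (bounded0_inv_shift z Hz) as [N B].
exists (fun t => (- / z ^ 3) * / (z + t))%C; split; [bounded0_tac |].
apply near0_imp with (2 := N); intros t Ht; field; auto.
Qed.

(** The pointwise substitute for analyticity used by the maximum principle. *)
Definition has_jet (h : C -> C) (z : C) : Prop :=
  exists c0 c1 c2 : C, jet h z c0 c1 c2.

Lemma has_jet_const (c z : C) : has_jet (fun _ => c) z.
Proof. do 3 eexists; apply jet_const. Qed.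

Lemma has_jet_id (z : C) : has_jet (fun w => w) z.
Proof. do 3 eexists; apply jet_id. Qed.

Lemma has_jet_plus (h k : C -> C) (z : C) :
  has_jet h z -> has_jet k z -> has_jet (fun w => h w + k w)%C z.
Proof.
intros (c0 & c1 & c2 & H) (d0 & d1 & d2 & K).
do 3 eexists; apply (jet_plus _ _ _ _ _ _ _ _ _ H K).
Qed.

Lemma has_jet_mult (h k : C -> C) (z : C) :
  has_jet h z -> has_jet k z -> has_jet (fun w => h w * k w)%C z.
Proof.
intros (c0 & c1 & c2 & H) (d0 & d1 & d2 & K).
do 3 eexists; apply (jet_mult _ _ _ _ _ _ _ _ _ H K).
Qed.

Lemma has_jet_pow (h : C -> C) (z : C) (n : nat) :
  has_jet h z -> has_jet (fun w => h w ^ n)%C z.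
Proof.
intros H; induction n as [| n IH]; [exact (has_jet_const (RtoC 1) z) |].
exact (has_jet_mult _ _ _ H IH).
Qed.

Lemma has_jet_comp (h k : C -> C) (z : C) :
  has_jet k z -> has_jet h (k z) -> has_jet (fun w => h (k w)) z.
Proof.
intros (d0 & d1 & d2 & K) (c0 & c1 & c2 & H).
rewrite (jet_value _ _ _ _ _ K) in H.
do 3 eexists; apply (jet_comp _ _ _ _ _ _ _ _ _ K H).
Qed.

Lemma has_jet_inv (h : C -> C) (z : C) :
  has_jet h z -> h z <> 0%C -> has_jet (fun w => / h w)%C z.
Proof.
intros H Hz; apply (has_jet_comp Cinv); auto.
do 3 eexists; now apply jet_inv.
Qed.

Definition continuous_at (G : C -> C) (z : C) : Prop :=
  forall eps : R, 0 < eps -> near0 (fun t => Cmod (G (z + t)%C - G z)%C < eps).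

Lemma has_jet_continuous (h : C -> C) (z : C) :
  has_jet h z -> continuous_at h z.
Proof.
intros (c0 & c1 & c2 & H) eps Heps.
rewrite (jet_value _ _ _ _ _ H).
destruct H as [e [He H]].
assert (Hs : bounded0 (fun t => c1 + c2 * t + (t * t) * e t)%C)
  by bounded0_tac.
assert (Hn : near0 (fun t => Cmod t < eps)) by (exists eps; auto).
apply near0_imp with (2 := near0_and _ _ H (near0_comp _ _ Hn Hs)).
intros t [A B]; rewrite A.
match type of B with Cmod ?x < _ => match goal with |- Cmod ?y < _ =>
  replace y with x by ring end end.
exact B.
Qed.

(** * Power series *)

Lemma pow_n_Cpow (z : C) (n : nat) : pow_n z n = (z ^ n)%C.
Proof. induction n as [| n IH]; [reflexivity |]; simpl; now rewrite IH. Qed.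

Lemma is_pseries_Cpow (c : nat -> C) (z l : C) :
  is_pseries c z l <-> is_series (fun n => z ^ n * c n)%C l.
Proof.
assert (E : forall n, scal (pow_n z n) (c n) = (z ^ n * c n)%C).
  intros n; rewrite pow_n_Cpow; reflexivity.
split; intros H; refine (is_series_ext _ _ _ _ H); intros n;
  [exact (E n) | exact (eq_sym (E n))].
Qed.

Lemma norm_Cmod (z : C) : @norm C_AbsRing C_NormedModule z = Cmod z.
Proof. reflexivity. Qed.

Lemma series_geom_bound (u : nat -> C) (l : C) (M : R) :
  is_series u l -> (forall n, Cmod (u n) <= M * (1 / 2) ^ n) ->
  Cmod l <= 2 * M.
Proof.
intros Hu Hb.
assert (HM : 0 <= M).
  pose proof (Hb 0%nat); pose proof (Cmod_ge_0 (u 0%nat)); simpl in *; lra.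
assert (HS : forall n, Cmod (sum_n u n) <= 2 * M - M * (1 / 2) ^ n).
  induction n as [| n IH].
  - rewrite sum_O; specialize (Hb 0%nat); simpl in *; lra.
  - rewrite sum_Sn.
    apply Rle_trans with (1 := Cmod_triangle _ _).
    specialize (Hb (S n)); simpl in *; lra.
assert (L : is_lim_seq (fun n => Cmod (sum_n u n)) (Cmod l)).
  exact (filterlim_comp _ _ _ _ _ _ _ _ Hu (filterlim_norm l)).
refine (is_lim_seq_le _ (fun _ => 2 * M) (Cmod l) (2 * M) _ L
          (is_lim_seq_const _)).
intros n; apply Rle_trans with (1 := HS n).
assert (0 < (1 / 2) ^ n) by (apply pow_lt; lra); nra.
Qed.

Lemma series_terms_bounded (u : nat -> C) (l : C) :
  is_series u l -> exists M, forall n, Cmod (u n) <= M.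
Proof.
intros Hu.
destruct (filterlim_bounded (sum_n u)) as [M HM].
  exists l; exact Hu.
exists (2 * M); intros [| n].
- pose proof (HM 0%nat) as H; rewrite sum_O, norm_Cmod in H.
  pose proof (Cmod_ge_0 (u 0%nat)); lra.
- pose proof (HM n) as H; pose proof (HM (S n)) as H'.
  rewrite norm_Cmod in H, H'; rewrite sum_Sn in H'.
  pose proof (Cmod_triangle (sum_n u n + u (S n)) (- sum_n u n)) as T.
  replace (sum_n u n + u (S n) + - sum_n u n)%C with (u (S n)) in T by ring.
  rewrite Cmod_opp in T.
  change (plus (sum_n u n) (u (S n))) with (sum_n u n + u (S n))%C in H'.
  lra.
Qed.

Lemma coef_bound (c : nat -> C) (rho : R) (l : C) :
  0 < rho -> is_pseries c (RtoC rho) l ->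
  exists M, forall n, Cmod (c n) * rho ^ n <= M.
Proof.
intros Hr H; apply is_pseries_Cpow in H.
destruct (series_terms_bounded _ _ H) as [M HM]; exists M; intros n.
specialize (HM n); rewrite Cmod_mult, Cmod_pow, Cmod_R in HM.
rewrite Rabs_pos_eq in HM by lra; lra.
Qed.

Lemma pseries_bound (c : nat -> C) (rho M : R) (z l : C) :
  0 < rho -> (forall n, Cmod (c n) * rho ^ n <= M) ->
  Cmod z <= rho / 2 -> is_pseries c z l -> Cmod l <= 2 * M.
Proof.
intros Hr Hc Hz H; apply is_pseries_Cpow in H.
apply series_geom_bound with (1 := H); intros n.
rewrite Cmod_mult, Cmod_pow.
apply Rle_trans with ((rho / 2) ^ n * Cmod (c n)).
  apply Rmult_le_compat_r; [apply Cmod_ge_0 |].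
  apply pow_incr; split; [apply Cmod_ge_0 | exact Hz].
replace (rho / 2) with (rho * (1 / 2)) by field.
rewrite Rpow_mult_distr.
assert (0 < (1 / 2) ^ n) by (apply pow_lt; lra).
specialize (Hc n); nra.
Qed.

Lemma pseries_at_0 (c : nat -> C) (l : C) :
  is_pseries c (RtoC 0) l -> l = c 0%nat.
Proof.
intros H; apply (filterlim_locally_unique _ _ _ H).
apply (is_pseries_0 c).
Qed.

(** Division by [z] is not available at [z = 0], where the quotient is the
    value [c 1] of the shifted series. *)
Lemma pseries_shift (c : nat -> C) (z l : C) :
  is_pseries c z l ->
  exists l' : C, is_pseries (PS_decr_1 c) z l' /\ l = (c 0%nat + z * l')%C.
Proof.
intros H; destruct (Ceq_dec z 0) as [-> | Hz].
- exists (c 1%nat); split; [apply (is_pseries_0 (PS_decr_1 c)) |].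
  rewrite (pseries_at_0 _ _ H); ring.
- exists (/ z * (l - c 0%nat))%C; split.
  + apply (is_pseries_decr_1 c z (/ z)%C l); [| exact H].
    now apply Cinv_l.
  + field; exact Hz.
Qed.

(** Removing three terms from the series leaves [t^3] times a power series,
    whose sum is bounded on a smaller disc by comparison with a geometric
    series. *)
Lemma jet_of_pseries (h : C -> C) (z : C) (c : nat -> C) :
  near0 (fun t => is_pseries c t (h (z + t)%C)) ->
  jet h z (c 0%nat) (c 1%nat) (c 2%nat).
Proof.
intros [r [Hr H]].
destruct (coef_bound c (r / 2) (h (z + RtoC (r / 2))%C)) as [M HM].
- lra.
- apply H; rewrite Cmod_R, Rabs_pos_eq; lra.
- set (c3 := PS_decr_1 (PS_decr_1 (PS_decr_1 c))).
  assert (Hc3 : forall n, Cmod (c3 n) * (r / 2) ^ n <= M / (r / 2) ^ 3).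
    intros n; unfold c3, PS_decr_1; specialize (HM (S (S (S n)))).
    apply (fun H => proj1 (Rle_div_r _ _ _ H)); [apply pow_lt; lra |].
    apply Rle_trans with (2 := HM); right; simpl; ring.
  (* Half the radius where the coefficients are controlled makes the terms
     decay like [2^-n]. *)
  assert (E : forall t, exists e, Cmod t < r / 4 ->
    Cmod e <= 2 * (M / (r / 2) ^ 3) /\
    h (z + t)%C = (c 0%nat + c 1%nat * t + c 2%nat * t ^ 2 + t ^ 3 * e)%C).
    intros t; destruct (Rlt_dec (Cmod t) (r / 4)) as [Ht | Ht].
    2: exists 0%C; intros; lra.
    assert (H0 : Cmod t < r) by lra; apply H in H0.
    destruct (pseries_shift _ _ _ H0) as [l1 [H1 E1]].
    destruct (pseries_shift _ _ _ H1) as [l2 [H2 E2]].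
    destruct (pseries_shift _ _ _ H2) as [l3 [H3 E3]].
    exists l3; intros _; split.
      apply (pseries_bound c3 (r / 2) _ t); auto; lra.
    rewrite E1, E2, E3; unfold PS_decr_1; ring.
  destruct (choice _ E) as [e He].
  exists e; split.
  + exists (2 * (M / (r / 2) ^ 3)); split.
      destruct (He 0%C) as [B _]; [rewrite Cmod_0; lra |].
      pose proof (Cmod_ge_0 (e 0%C)); lra.
    exists (r / 4); split; [lra | intros t Ht; now apply He].
  + exists (r / 4); split; [lra | intros t Ht; now apply He].
Qed.

Lemma expansion_jet (h : C -> C) (c : nat -> C) :
  near0 (fun t => is_pseries c t (h t)) ->
  jet h 0 (c 0%nat) (c 1%nat) (c 2%nat).
Proof.
intros H; apply jet_of_pseries.
apply near0_imp with (2 := H); intros t Ht.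
now replace (0 + t)%C with t by ring.
Qed.

Lemma analytic_has_jet (D : C -> Prop) (h : C -> C) (z : C) :
  analytic_on D h -> D z -> has_jet h z.
Proof.
intros H Hz; destruct (H z Hz) as [c [r [Hr Hc]]].
do 3 eexists; apply (jet_of_pseries h z c).
exists r; split; auto; intros t Ht.
replace t with (z + t - z)%C at 1 by ring.
apply Hc; now replace (z + t - z)%C with t by ring.
Qed.

(** A second-order expansion of [F z / z] gives access to the third coefficient
    of [F]; [c1] is the value that continues the quotient to 0. *)
Definition difference_quotient (F : C -> C) (c1 z : C) : C :=
  if Ceq_dec z (RtoC 0) then c1 else (F z / z)%C.

Lemma pseries_quotient (F : C -> C) (c : nat -> C) (z : C) :
  c 0%nat = 0%C -> is_pseries c z (F z) ->
  is_pseries (PS_decr_1 c) z (difference_quotient F (c 1%nat) z).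
Proof.
intros H0 H; unfold difference_quotient.
destruct (pseries_shift _ _ _ H) as [l [Hl E]].
destruct (Ceq_dec z 0) as [Hz | Hz].
- rewrite Hz; apply (is_pseries_0 (PS_decr_1 c)).
- assert (E' : (F z / z)%C = l) by (rewrite E, H0; field; exact Hz).
  now rewrite E'.
Qed.

(** The second-order Taylor error of [x^n] at [w].  It obeys
    [p_(n+1) = x p_n + n w^(n-1) (x - w)^2], whence the induction; the crude
    factor [4^n] absorbs [n] and is harmless since the series will only be
    differentiated near 0. *)
Lemma pow_increment_bound (s : R) (x w : C) (n : nat) :
  0 < s -> Cmod x <= s -> Cmod w <= s ->
  s ^ 2 * Cmod (x ^ n - w ^ n - INR n * w ^ pred n * (x - w))%C
    <= Cmod (x - w)%C ^ 2 * (4 * s) ^ n.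
Proof.
intros Hs Hx Hw; set (d := (x - w)%C).
assert (E : forall m, (INR m * w ^ pred m * w)%C = (INR m * w ^ m)%C).
  intros [| m]; simpl; [ring | ring].
induction n as [| n IH].
- replace (x ^ 0 - w ^ 0 - INR 0 * w ^ pred 0 * d)%C with (RtoC 0)
    by (simpl; ring).
  rewrite Cmod_0; simpl; pose proof (Cmod_ge_0 d); nra.
- replace (x ^ S n - w ^ S n - INR (S n) * w ^ pred (S n) * d)%C
    with (x * (x ^ n - w ^ n - INR n * w ^ pred n * d)
          + INR n * w ^ pred n * d ^ 2)%C.
  2:{ rewrite S_INR, RtoC_plus; simpl pred.
      transitivity (x * (x ^ n - w ^ n) + (INR n * w ^ pred n * w) * - d)%C.
      - unfold d; ring.
      - rewrite E; unfold d; rewrite !Cpow_S; ring. }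
  set (p := (x ^ n - w ^ n - INR n * w ^ pred n * d)%C) in *.
  pose proof (Cmod_triangle (x * p) (INR n * w ^ pred n * d ^ 2)) as T.
  rewrite !Cmod_mult, !Cmod_pow, Cmod_R, (Rabs_pos_eq _ (pos_INR n)) in T.
  pose proof (Cmod_ge_0 d) as Hd; pose proof (Cmod_ge_0 p) as Hp.
  assert (B : s * (INR n * Cmod w ^ pred n) <= (4 * s) ^ n).
    destruct n as [| n]; [simpl; lra |].
    simpl pred; rewrite Rpow_mult_distr.
    assert (B1 : Cmod w ^ n <= s ^ n)
      by (apply pow_incr; split; auto using Cmod_ge_0).
    assert (B2 : INR (S n) <= 4 ^ S n).
      clear; induction n as [| n IH]; [simpl; lra |].
      rewrite S_INR; rewrite <- tech_pow_Rmult.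
      assert (1 <= 4 ^ S n) by (apply pow_R1_Rle; lra); lra.
    replace (4 ^ S n * s ^ S n) with (s * (4 ^ S n * s ^ n)) by (simpl; ring).
    apply Rmult_le_compat_l; [lra |].
    apply Rmult_le_compat; auto using pos_INR.
    apply pow_le, Cmod_ge_0.
  assert (B3 : s ^ 2 * (Cmod x * Cmod p) <= s * (Cmod d ^ 2 * (4 * s) ^ n)).
    apply Rle_trans with (s * (s ^ 2 * Cmod p)).
      replace (s ^ 2 * (Cmod x * Cmod p)) with (Cmod x * (s ^ 2 * Cmod p))
        by ring.
      apply Rmult_le_compat_r; auto.
      apply Rmult_le_pos; auto; apply pow_le; lra.
    now apply Rmult_le_compat_l; [lra |].
  assert (B4 : s ^ 2 * (INR n * Cmod w ^ pred n * Cmod d ^ 2)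
               <= s * (Cmod d ^ 2 * (4 * s) ^ n)).
    replace (s ^ 2 * (INR n * Cmod w ^ pred n * Cmod d ^ 2))
      with (s * (Cmod d ^ 2 * (s * (INR n * Cmod w ^ pred n)))) by ring.
    apply Rmult_le_compat_l; [lra |].
    apply Rmult_le_compat_l; auto; nra.
  assert (B5 : 0 <= Cmod d ^ 2 * (4 * s) ^ n).
    apply Rmult_le_pos; apply pow_le; lra.
  apply Rle_trans with
    (s ^ 2 * (Cmod x * Cmod p + INR n * Cmod w ^ pred n * Cmod d ^ 2)).
    apply Rmult_le_compat_l; auto; apply pow_le; lra.
  simpl ((4 * s) ^ S n); nra.
Qed.

(** Term-by-term differentiation near 0.  Summing [pow_increment_bound] against
    the coefficients bounds [F x - F w - d (x - w)] by a multiple of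
    [|x - w|^2], where [d] is the sum of the differentiated series. *)
Lemma pseries_derive (F : C -> C) (c : nat -> C) :
  near0 (fun z => is_pseries c z (F z)) ->
  near0 (fun z => is_pseries (fun n => INR (S n) * c (S n))%C z (C_derive F z)).
Proof.
intros [r [Hr H]].
destruct (coef_bound c (r / 2) (F (RtoC (r / 2)))) as [M HM].
- lra.
- apply H; rewrite Cmod_R, Rabs_pos_eq; lra.
(* [s = rho / 8] makes [(4 s)^n = rho^n 2^-n], so that both series below are
   dominated by a geometric series of ratio 1/2. *)
- set (rho := r / 2) in *; set (s := rho / 8).
  assert (Hrho : 0 < rho) by (unfold rho; lra).
  assert (Hs : 0 < s) by (unfold s; lra).
  assert (HM0 : 0 <= M).
    pose proof (HM 0%nat); pose proof (Cmod_ge_0 (c 0%nat)); simpl in *; lra.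
  exists s; split; auto; intros w Hw.
  set (v := fun n => (w ^ n * (INR (S n) * c (S n)))%C).
  assert (Hv : exists d : C, is_series v d).
    apply (@ex_series_le _ C_CompleteNormedModule v
             (fun n => (M / rho) * (1 / 2) ^ n)).
    + intros n; change (Cmod (v n) <= M / rho * (1 / 2) ^ n); unfold v.
      rewrite !Cmod_mult, Cmod_pow, Cmod_R, (Rabs_pos_eq _ (pos_INR _)).
      assert (B1 : Cmod w ^ n <= s ^ n)
        by (apply pow_incr; split; [apply Cmod_ge_0 | lra]).
      assert (B2 : INR (S n) <= 4 ^ n).
        clear; induction n as [| n IH]; [simpl; lra |].
        rewrite S_INR; rewrite <- tech_pow_Rmult.
        assert (1 <= 4 ^ n) by (apply pow_R1_Rle; lra); lra.
      assert (B3 : (s ^ n * 4 ^ n = rho ^ n * (1 / 2) ^ n)).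
        rewrite <- !Rpow_mult_distr; f_equal; unfold s; field.
      assert (B4 : Cmod (c (S n)) * rho ^ n <= M / rho).
        apply (fun H => proj1 (Rle_div_r _ _ _ H)); auto.
        apply Rle_trans with (2 := HM (S n)); right; simpl; ring.
      apply Rle_trans with (s ^ n * (4 ^ n * Cmod (c (S n)))).
        apply Rmult_le_compat; auto.
        * apply pow_le, Cmod_ge_0.
        * apply Rmult_le_pos; [apply pos_INR | apply Cmod_ge_0].
        * apply Rmult_le_compat_r; auto; apply Cmod_ge_0.
      rewrite <- Rmult_assoc, B3.
      assert (0 < (1 / 2) ^ n) by (apply pow_lt; lra); nra.
    + exists (M / rho * (/ (1 - 1 / 2))).
      apply (@is_series_scal_l R_AbsRing R_NormedModule).
      apply is_series_geom; rewrite Rabs_pos_eq; lra.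
  destruct Hv as [d Hd].
  assert (B : forall x, Cmod x < s ->
    Cmod (F x - F w - d * (x - w))%C <= 2 * (M / s ^ 2 * Cmod (x - w)%C ^ 2)).
    intros x Hx.
    assert (Sx := proj1 (is_pseries_Cpow _ _ _)
      (H x ltac:(unfold s, rho in *; lra))).
    assert (Sw := proj1 (is_pseries_Cpow _ _ _)
      (H w ltac:(unfold s, rho in *; lra))).
    assert (Sd : is_series (fun n => INR n * w ^ pred n * c n)%C d).
      apply is_series_decr_1.
      apply is_series_ext with v; [intros n; unfold v; simpl; ring |].
      refine (eq_ind d (is_series v) Hd _ _).
      change (d = d + - (INR 0 * w ^ pred 0 * c 0%nat))%C; simpl; ring.
    assert (HS := is_series_minus _ _ _ _ (is_series_minus _ _ _ _ Sx Sw)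
      (is_series_scal (x - w)%C _ _ Sd)).
    replace (F x - F w - d * (x - w))%C
      with (F x - F w - (x - w) * d)%C by ring.
    apply series_geom_bound with (1 := HS); intros n.
    match goal with |- Cmod ?a <= _ =>
      replace a with (c n * (x ^ n - w ^ n - INR n * w ^ pred n * (x - w)))%C
    end.
    2:{ change ((c n * (x ^ n - w ^ n - INR n * w ^ pred n * (x - w)))%C =
          (x ^ n * c n - w ^ n * c n
            - (x - w) * (INR n * w ^ pred n * c n))%C); ring. }
    rewrite Cmod_mult.
    pose proof (pow_increment_bound s x w n Hs
      (Rlt_le _ _ Hx) (Rlt_le _ _ Hw)) as P.
    set (y := Cmod (x ^ n - w ^ n - INR n * w ^ pred n * (x - w))%C) in *.
    set (D := Cmod (x - w)%C) in *.
    assert (HD : 0 <= D) by apply Cmod_ge_0.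
    apply Rmult_le_reg_l with (s ^ 2); [apply pow_lt; lra |].
    replace (s ^ 2 * (M / s ^ 2 * D ^ 2 * (1 / 2) ^ n))
      with (D ^ 2 * (M * (1 / 2) ^ n)) by (field; lra).
    replace (s ^ 2 * (Cmod (c n) * y)) with (Cmod (c n) * (s ^ 2 * y)) by ring.
    apply Rle_trans with (Cmod (c n) * (D ^ 2 * (4 * s) ^ n)).
      apply Rmult_le_compat_l; auto; apply Cmod_ge_0.
    replace ((4 * s) ^ n) with (rho ^ n * (1 / 2) ^ n).
    2:{ rewrite <- Rpow_mult_distr; f_equal; unfold s; field. }
    replace (Cmod (c n) * (D ^ 2 * (rho ^ n * (1 / 2) ^ n)))
      with (D ^ 2 * ((Cmod (c n) * rho ^ n) * (1 / 2) ^ n)) by ring.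
    apply Rmult_le_compat_l; [nra |].
    apply Rmult_le_compat_r; auto; left; apply pow_lt; lra.
  replace (C_derive F w) with d.
    apply is_pseries_Cpow; exact Hd.
  symmetry; unfold C_derive; apply is_C_lim_unique.
  set (A := 2 * (M / s ^ 2)) in *.
  assert (HA : 0 <= A).
    unfold A; apply Rmult_le_pos; [lra |].
    apply Rdiv_le_0_compat; auto; apply pow_lt; lra.
  intros P [eps HP].
  set (del := Rmin (s - Cmod w) (eps / (A + 1))).
  assert (Hdel : 0 < del / 2).
    apply Rdiv_lt_0_compat; [| lra]; apply Rmin_pos; [lra |].
    apply Rdiv_lt_0_compat; [apply cond_pos | lra].
  exists (mkposreal _ Hdel); intros x Hb Hx; change C in (type of x).
  apply HP, C_NormedModule_mixin_compat1.
  apply C_NormedModule_mixin_compat2 in Hb.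
  change (Cmod (x - w)%C < sqrt 2 * (del / 2)) in Hb.
  assert (Hxw : Cmod (x - w)%C < del).
    assert (sqrt 2 <= 2).
      rewrite <- (sqrt_square 2) at 2 by lra; apply sqrt_le_1_alt; lra.
    nra.
  assert (D1 : del <= s - Cmod w) by apply Rmin_l.
  assert (D2 : del <= eps / (A + 1)) by apply Rmin_r.
  assert (Hxs : Cmod x < s).
    pose proof (Cmod_triangle w (x - w)) as T.
    replace (w + (x - w))%C with x in T by ring; lra.
  assert (Hne : (x - w)%C <> 0%C).
    intros E; apply Hx; change (@eq C x w).
    replace x with (x - w + w)%C by ring; rewrite E; ring.
  change (Cmod ((F x - F w) / (x - w) - d)%C < eps).
  replace ((F x - F w) / (x - w) - d)%C
    with ((F x - F w - d * (x - w)) / (x - w))%C by (field; auto).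
  rewrite Cmod_div by auto.
  apply Cmod_gt_0 in Hne; specialize (B x Hxs).
  apply (fun H => proj2 (Rlt_div_l _ _ _ H)); auto.
  apply Rle_lt_trans with (1 := B).
  replace (2 * (M / s ^ 2 * Cmod (x - w)%C ^ 2))
    with (A * Cmod (x - w)%C * Cmod (x - w)%C) by (unfold A; ring).
  apply Rmult_lt_compat_r; auto.
  assert (E : eps / (A + 1) * (A + 1) = eps) by (field; lra).
  nra.
Qed.

(** * The maximum principle *)

(** Compactness of the closed disc in gauge form: a property that holds locally
    with some margin [d] holds everywhere with one common margin.  Points of
    the enclosing square outside the disc get a gauge so small that it
    never reaches the disc. *)
Lemma disc_gauge (r : R) (Q : C -> R -> Prop) :
  (forall z d d', 0 < d' <= d -> Q z d -> Q z d') ->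
  (forall z, Cmod z <= r -> exists d, 0 < d /\
     forall z', Cmod z' <= r -> Cmod (z' - z)%C < d -> Q z' d) ->
  exists d, 0 < d /\ forall z, Cmod z <= r -> Q z d.
Proof.
intros Hmono Hloc.
assert (H : forall z : C, exists d : posreal,
  forall z', Cmod z' <= r -> Cmod (z' - z)%C < 2 * d -> Q z' d).
  intros z; destruct (Rle_dec (Cmod z) r) as [Hz | Hz].
  - destruct (Hloc z Hz) as [d [Hd H]].
    assert (Hd2 : 0 < d / 2) by lra.
    exists (mkposreal _ Hd2); intros z' Hz' Hzz; simpl in *.
    apply Hmono with d; [lra |]; apply H; auto; lra.
  - assert (Hd : 0 < (Cmod z - r) / 2) by lra.
    exists (mkposreal _ Hd); intros z' Hz' Hzz; exfalso; simpl in Hzz.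
    pose proof (Cmod_triangle z' (- (z' - z))) as T.
    rewrite Cmod_opp in T.
    replace (z' + - (z' - z))%C with z in T by ring; lra.
destruct (choice _ H) as [delta Hdelta].
destruct (compactness_value_2d (- r) r (- r) r
            (fun x y => delta (x, y))) as [d Hd].
exists d; split; [apply cond_pos |]; intros z Hz.
pose proof (Rmax_Cmod z) as Hxy.
assert (H1 : Rabs (fst z) <= r).
  apply Rle_trans with (2 := Hz), Rle_trans with (2 := Hxy), Rmax_l.
assert (H2 : Rabs (snd z) <= r).
  apply Rle_trans with (2 := Hz), Rle_trans with (2 := Hxy), Rmax_r.
apply Rabs_le_between in H1, H2.
specialize (Hd _ _ H1 H2); apply NNPP in Hd.
destruct Hd as (u & v & _ & _ & Hu & Hv & Hle).
apply Hmono with (delta (u, v)); [split; auto; apply cond_pos |].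
apply Hdelta; auto.
apply Rle_lt_trans with (1 := Cmod_2Rmax _).
change (fst (z - (u, v))%C) with (fst z - u).
change (snd (z - (u, v))%C) with (snd z - v).
assert (Hm : Rmax (Rabs (fst z - u)) (Rabs (snd z - v)) < delta (u, v))
  by now apply Rmax_lub_lt.
assert (sqrt 2 <= 2).
  rewrite <- (sqrt_square 2) at 2 by lra; apply sqrt_le_1_alt; lra.
pose proof (Rmax_l (Rabs (fst z - u)) (Rabs (snd z - v))).
pose proof (Rabs_pos (fst z - u)).
pose proof (sqrt_pos 2); nra.
Qed.

(** Two uses of [disc_gauge]: with [u <= 1 / d] to bound [u], and
    with [u <= S - d] to contradict that the supremum [S] is not attained. *)
Lemma disc_maximum (r : R) (u : C -> R) :
  0 <= r ->
  (forall z, Cmod z <= r -> forall eps, 0 < eps ->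
     near0 (fun t => u (z + t)%C < u z + eps)) ->
  exists z, Cmod z <= r /\ forall z', Cmod z' <= r -> u z' <= u z.
Proof.
intros Hr Hu.
assert (Hbound : exists M, forall z, Cmod z <= r -> u z <= M).
  destruct (disc_gauge r (fun z d => u z <= / d)) as [d [Hd H]].
  - intros z d d' Hdd H; apply Rle_trans with (1 := H).
    apply Rinv_le_contravar; lra.
  - intros z Hz; destruct (Hu z Hz 1 Rlt_0_1) as [s [Hs H]].
    set (b := Rabs (u z) + 1).
    assert (Hb : 0 < b) by (unfold b; pose proof (Rabs_pos (u z)); lra).
    exists (Rmin s (/ b)); split.
      apply Rmin_pos; auto; now apply Rinv_0_lt_compat.
    intros z' _ Hzz.
    assert (Hlt : u z' < u z + 1).
      replace z' with (z + (z' - z))%C by ring; apply H.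
      apply Rlt_le_trans with (1 := Hzz), Rmin_l.
    apply Rle_trans with b.
      unfold b; pose proof (Rle_abs (u z)); lra.
    apply Rle_trans with (/ / b); [rewrite Rinv_inv; lra |].
    apply Rinv_le_contravar; [| apply Rmin_r].
    apply Rmin_pos; auto; now apply Rinv_0_lt_compat.
  - exists (/ d); exact H.
destruct Hbound as [M HM].
destruct (completeness (fun y => exists z, Cmod z <= r /\ y = u z))
  as [S [HS1 HS2]].
- exists M; intros y (z & Hz & ->); auto.
- exists (u 0%C), 0%C; rewrite Cmod_0; auto.
- apply NNPP; intros N.
  assert (Hlt : forall z, Cmod z <= r -> u z < S).
    intros z Hz; apply Rnot_le_lt; intros HSz; apply N.
    exists z; split; auto; intros z' Hz'.
    apply Rle_trans with (2 := HSz), HS1; eauto.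
  destruct (disc_gauge r (fun z d => u z <= S - d)) as [d [Hd H]].
  + intros z d d' Hdd H; lra.
  + intros z Hz; specialize (Hlt z Hz).
    destruct (Hu z Hz ((S - u z) / 2)) as [s [Hs H]]; [lra |].
    exists (Rmin s ((S - u z) / 2)); split; [apply Rmin_pos; lra |].
    intros z' _ Hzz.
    assert (Hz' : u z' < u z + (S - u z) / 2).
      replace z' with (z + (z' - z))%C by ring; apply H.
      apply Rlt_le_trans with (1 := Hzz), Rmin_l.
    pose proof (Rmin_r s ((S - u z) / 2)); lra.
  + assert (S <= S - d); [| lra].
    apply HS2; intros y (z & Hz & ->); auto.
Qed.

(** Over the four directions the sums of [t], of [t^2] and of [t] times the
    conjugate of [t^2] vanish, so all cross terms cancel: a four-point Parseval
    identity. *)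
Lemma four_directions (c0 c1 c2 : C) (x : R) :
  let p t := (c0 + c1 * t + c2 * t ^ 2)%C in
  Cmod (p (RtoC x)) ^ 2 + Cmod (p (RtoC (- x))) ^ 2
  + Cmod (p (0, x)) ^ 2 + Cmod (p (0, - x)) ^ 2
  = 4 * (Cmod c0 ^ 2 + Cmod c1 ^ 2 * x ^ 2 + Cmod c2 ^ 2 * x ^ 4).
Proof.
intros p; unfold p; rewrite !Cmod2_alt.
destruct c0 as [a0 b0], c1 as [a1 b1], c2 as [a2 b2].
unfold Re, Im; simpl; ring.
Qed.

(** The mean of [|h|^2 + eps |.|^2] over the four points at distance [x] exceeds
    its value at the centre by at least [eps x^2 - O(x^3)].  The term [eps]
    makes this strict even where [h] is locally constant. *)
Lemma no_interior_maximum (h : C -> C) (z : C) (eps : R) :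
  0 < eps -> has_jet h z ->
  ~ near0 (fun t => Cmod (h (z + t)%C) ^ 2 + eps * Cmod (z + t)%C ^ 2
                    <= Cmod (h z) ^ 2 + eps * Cmod z ^ 2).
Proof.
intros Heps (c0 & c1 & c2 & Hj) Hmax.
rewrite (jet_value _ _ _ _ _ Hj) in Hmax.
destruct Hj as [e [[K [HK He]] Hj]].
destruct (near0_and _ _ (near0_and _ _ He Hj) Hmax) as [r [Hr H]].
set (L := Cmod c0 + Cmod c1 + Cmod c2).
pose proof (Cmod_ge_0 c0); pose proof (Cmod_ge_0 c1); pose proof (Cmod_ge_0 c2).
assert (HL : 0 <= L) by (unfold L; lra).
set (x := Rmin 1 (Rmin (r / 2) (eps / (2 * L * K + 1)))).
assert (HLK : 0 <= 2 * L * K) by (apply Rmult_le_pos; lra).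
assert (Hx0 : 0 < x).
  unfold x; repeat apply Rmin_pos; try lra; apply Rdiv_lt_0_compat; lra.
assert (Hx1 : x <= 1) by apply Rmin_l.
assert (Hx2 : x <= r / 2).
  apply Rle_trans with (1 := Rmin_r _ _), Rmin_l.
assert (Hx3 : x <= eps / (2 * L * K + 1)).
  apply Rle_trans with (1 := Rmin_r _ _), Rmin_r.
set (p := fun t => (c0 + c1 * t + c2 * t ^ 2)%C).
assert (B : forall t, Cmod t = x ->
  Cmod (p t) ^ 2 - 2 * L * K * x ^ 3 + eps * Cmod (z + t)%C ^ 2
    <= Cmod c0 ^ 2 + eps * Cmod z ^ 2).
  intros t Ht; destruct (H t) as [[E1 E2] E3]; [lra |].
  apply Rle_trans with (2 := E3), Rplus_le_compat_r.
  assert (P : Cmod (p t) <= L).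
    unfold p, L; apply Rle_trans with (1 := Cmod_triangle _ _).
    rewrite Cmod_mult, Cmod_pow, Ht.
    assert (x ^ 2 <= 1) by nra.
    apply Rplus_le_compat; [| nra].
    apply Rle_trans with (1 := Cmod_triangle _ _).
    rewrite Cmod_mult, Ht; nra.
  assert (T : Cmod (p t) <= Cmod (h (z + t)%C) + x ^ 3 * K).
    pose proof (Cmod_triangle (h (z + t)%C) (- (t ^ 3 * e t))) as T.
    rewrite Cmod_opp, Cmod_mult, Cmod_pow, Ht in T.
    replace (h (z + t) + - (t ^ 3 * e t))%C with (p t) in T
      by (rewrite E2; unfold p; ring).
    apply Rle_trans with (1 := T), Rplus_le_compat_l.
    apply Rmult_le_compat_l; auto; apply pow_le; lra.
  pose proof (Cmod_ge_0 (p t)) as P0.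
  pose proof (Cmod_ge_0 (h (z + t)%C)) as P1.
  assert (HxK : 0 <= x ^ 3 * K).
    apply Rmult_le_pos; auto; apply pow_le; lra.
  replace (2 * L * K * x ^ 3) with (2 * L * (x ^ 3 * K)) by ring.
  set (y := x ^ 3 * K) in *.
  destruct (Rle_dec y (Cmod (p t))); nra.
assert (M1 : Cmod (RtoC x) = x) by (rewrite Cmod_R; apply Rabs_pos_eq; lra).
assert (M2 : Cmod (RtoC (- x)) = x).
  rewrite Cmod_R, Rabs_Ropp; apply Rabs_pos_eq; lra.
assert (M3 : Cmod (0, x) = x).
  replace (0, x) with (Ci * x)%C.
    rewrite Cmod_mult, Cmod_Ci, M1; ring.
  unfold Ci, Cmult; simpl; f_equal; ring.
assert (M4 : Cmod (0, - x) = x).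
  replace (0, - x) with (- (0, x))%C.
    now rewrite Cmod_opp.
  unfold Copp; simpl; f_equal; ring.
pose proof (B _ M1); pose proof (B _ M2); pose proof (B _ M3);
  pose proof (B _ M4).
pose proof (four_directions c0 c1 c2 x) as S1; cbv beta zeta in S1.
pose proof (four_directions z 1 0 x) as S2; cbv beta zeta in S2.
rewrite Cmod_1, Cmod_0 in S2.
assert (Ez : forall t, (z + 1 * t + 0 * t ^ 2)%C = (z + t)%C)
  by (intros t; ring).
rewrite !Ez in S2.
unfold p in *.
apply (f_equal (Rmult eps)) in S2.
assert (0 <= Cmod c1 ^ 2 * x ^ 2) by (apply Rmult_le_pos; apply pow_le; lra).
assert (0 <= Cmod c2 ^ 2 * x ^ 4) by (apply Rmult_le_pos; apply pow_le; lra).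
assert (F : eps * x ^ 2 <= 2 * L * K * x ^ 3).
  lra.
assert (F2 : eps <= 2 * L * K * x).
  apply Rmult_le_reg_r with (x ^ 2); [apply pow_lt; lra |].
  apply Rle_trans with (1 := F); right; ring.
assert (F3 : eps / (2 * L * K + 1) * (2 * L * K + 1) = eps) by (field; lra).
nra.
Qed.

Lemma square_usc (a eps : R) :
  0 <= a -> 0 < eps ->
  exists d, 0 < d /\ forall b, 0 <= b -> b < a + d -> b ^ 2 < a ^ 2 + eps.
Proof.
intros Ha Heps; exists (Rmin 1 (eps / (2 * a + 1))).
assert (H : 0 < eps / (2 * a + 1)) by (apply Rdiv_lt_0_compat; lra).
assert (E : eps / (2 * a + 1) * (2 * a + 1) = eps) by (field; lra).
pose proof (Rmin_l 1 (eps / (2 * a + 1))).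
pose proof (Rmin_r 1 (eps / (2 * a + 1))).
set (d := Rmin 1 (eps / (2 * a + 1))) in *.
assert (0 < d) by (apply Rmin_pos; lra).
split; auto; intros b Hb Hbd.
assert (b ^ 2 < (a + d) ^ 2) by (simpl; nra).
assert (d * (2 * a + d) <= eps / (2 * a + 1) * (2 * a + 1)).
  apply Rmult_le_compat; lra.
nra.
Qed.

(** The maximum of [|G|^2 + eps |z|^2] is on the circle: [no_interior_maximum]
    excludes interior points where [G] does not vanish, and at an interior zero
    of [G] the value [eps |z|^2] is less than those on the circle.  Restricting
    the expansions to the points where [G] does not vanish lets
    [schwarz_order_2] use a function that is merely continuous at 0. *)
Lemma max_modulus (G : C -> C) (r M : R) :
  0 < r ->
  (forall z, Cmod z <= r -> continuous_at G z) ->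
  (forall z, Cmod z < r -> G z <> 0%C -> has_jet G z) ->
  (forall z, Cmod z = r -> Cmod (G z) <= M) ->
  forall z, Cmod z <= r -> Cmod (G z) <= M.
Proof.
intros Hr Hcont Hjet HM.
assert (Hrr : Cmod (RtoC r) = r) by (rewrite Cmod_R; apply Rabs_pos_eq; lra).
assert (HM0 : 0 <= M).
  pose proof (HM _ Hrr); pose proof (Cmod_ge_0 (G (RtoC r))); lra.
assert (B : forall eps, 0 < eps -> forall z, Cmod z <= r ->
  Cmod (G z) ^ 2 + eps * Cmod z ^ 2 <= M ^ 2 + eps * r ^ 2).
  intros eps Heps.
  set (u := fun z => Cmod (G z) ^ 2 + eps * Cmod z ^ 2).
  destruct (disc_maximum r u) as [z0 [Hz0 Hmax]]; [lra | |].
    intros z Hz eta Heta; unfold u.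
    destruct (square_usc (Cmod (G z)) (eta / 2)) as [d1 [Hd1 H1]];
      [apply Cmod_ge_0 | lra |].
    destruct (square_usc (Cmod z) (eta / (2 * eps))) as [d2 [Hd2 H2]];
      [apply Cmod_ge_0 | apply Rdiv_lt_0_compat; lra |].
    assert (N : near0 (fun t => Cmod t < d2)) by (exists d2; auto).
    apply near0_imp with (2 := near0_and _ _ N (Hcont z Hz d1 Hd1)).
    intros t [T1 T2].
    assert (Q1 : Cmod (G (z + t)%C) ^ 2 < Cmod (G z) ^ 2 + eta / 2).
      apply H1; [apply Cmod_ge_0 |].
      pose proof (Cmod_triangle (G z) (G (z + t)%C - G z)) as T.
      replace (G z + (G (z + t) - G z))%C with (G (z + t)%C) in T by ring.
      lra.
    assert (Q2 : Cmod (z + t)%C ^ 2 < Cmod z ^ 2 + eta / (2 * eps)).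
      apply H2; [apply Cmod_ge_0 |].
      pose proof (Cmod_triangle z t); lra.
    assert (E : eps * (eta / (2 * eps)) = eta / 2) by (field; lra).
    nra.
  assert (Hb : u z0 <= M ^ 2 + eps * r ^ 2).
    destruct (Rle_lt_or_eq_dec _ _ Hz0) as [Hin | Hbd].
    - destruct (Ceq_dec (G z0) 0) as [E | E].
      + unfold u; rewrite E, Cmod_0.
        pose proof (Cmod_ge_0 z0).
        assert (Cmod z0 ^ 2 <= r ^ 2) by (apply pow_incr; lra).
        assert (0 <= M ^ 2) by (apply pow_le; lra).
        nra.
      + exfalso.
        apply (no_interior_maximum G z0 eps Heps (Hjet z0 Hin E)).
        exists (r - Cmod z0); split; [lra |]; intros t Ht.
        apply (Hmax (z0 + t)%C).
        pose proof (Cmod_triangle z0 t); lra.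
    - unfold u; rewrite Hbd; apply Rplus_le_compat_r.
      apply pow_incr; split; auto using Cmod_ge_0.
  intros z Hz; apply Rle_trans with (2 := Hb); exact (Hmax z Hz).
intros z Hz.
assert (S : Cmod (G z) ^ 2 <= M ^ 2).
  apply Rle_plus_epsilon; intros eta Heta.
  assert (Hr2 : 0 < r ^ 2) by (apply pow_lt; lra).
  assert (He : 0 < eta / r ^ 2) by now apply Rdiv_lt_0_compat.
  specialize (B _ He z Hz).
  replace (eta / r ^ 2 * r ^ 2) with eta in B by (field; lra).
  assert (0 <= eta / r ^ 2 * Cmod z ^ 2); [| lra].
  apply Rmult_le_pos; [lra | apply pow_le, Cmod_ge_0].
pose proof (Cmod_ge_0 (G z)); nra.
Qed.

Lemma pow_bounded_le_1 (x L : R) : (forall n, x ^ n <= L) -> x <= 1.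
Proof.
intros H; apply Rnot_lt_le; intros Hx.
destruct (Pow_x_infinity x) with (b := L + 1) as [N HN].
  rewrite Rabs_pos_eq; lra.
specialize (HN N (le_n N)); specialize (H N).
rewrite Rabs_pos_eq in HN by (apply pow_le; lra); lra.
Qed.

(** * Schwarz's lemma at a double zero *)

(** The quotient [H = F / z^2] is bounded near 0 but has no known expansion
    there.  The function [z H^n] is continuous at 0, vanishes there, and is
    bounded by [r (1 / r^2)^n] on the circle of radius [r]; hence
    [(|H(z)| r^2)^n <= r / |z|] for every [n], which forces [|H(z)| r^2 <= 1].
    Finally [r] tends to 1. *)
Lemma schwarz_order_2 (F : C -> C) :
  (forall z, Cmod z < 1 -> has_jet F z) ->
  (forall z, Cmod z < 1 -> Cmod (F z) <= 1) ->
  (exists K, near0 (fun z => Cmod (F z) <= K * Cmod z ^ 2)) ->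
  forall z, Cmod z < 1 -> Cmod (F z) <= Cmod z ^ 2.
Proof.
intros Hjet Hle [K HK] z Hz.
destruct (Ceq_dec z 0) as [-> | Hz0].
  apply near0_at0 in HK; rewrite Cmod_0 in HK |- *; simpl in *; lra.
pose proof (proj1 (Cmod_gt_0 z) Hz0) as Hzp.
assert (B : forall r, Cmod z <= r < 1 -> Cmod (F z) * r ^ 2 <= Cmod z ^ 2).
  intros r [Hr1 Hr2].
  (* Whatever [/ 0] is, [z H(z)^n] vanishes at 0. *)
  set (H := fun w => (F w * / w ^ 2)%C).
  assert (HH : forall n, Cmod z * Cmod (H z) ^ n <= r * (1 / r ^ 2) ^ n).
    intros n.
    set (G := fun w => (w * H w ^ n)%C).
    assert (HG : Cmod (G z) <= r * (1 / r ^ 2) ^ n).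
      apply (max_modulus G r); [lra | | | | exact Hr1].
      - intros w Hw; destruct (Ceq_dec w 0) as [-> | Hw0].
        + assert (HHb : near0 (fun t => t <> 0%C -> Cmod (H t) <= Rabs K)).
            apply near0_imp with (2 := HK); intros t Ht Ht0.
            unfold H; rewrite Cmod_mult, Cmod_inv, Cmod_pow
              by now apply Cpow_nz.
            apply Cmod_gt_0 in Ht0.
            assert (0 < Cmod t ^ 2) by now apply pow_lt.
            apply (fun H => proj2 (Rle_div_l _ _ _ H)); auto.
            apply Rle_trans with (1 := Ht).
            pose proof (Rle_abs K); nra.
          intros eps Heps.
          assert (HKn : 0 <= Rabs K ^ n) by apply pow_le, Rabs_pos.
          assert (N : near0 (fun t => Cmod t < eps / (Rabs K ^ n + 1))).
            exists (eps / (Rabs K ^ n + 1)); split; auto.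
            apply Rdiv_lt_0_compat; lra.
          apply near0_imp with (2 := near0_and _ _ HHb N).
          intros t [T1 T2]; unfold G.
          replace (0 + t)%C with t by ring.
          replace (t * H t ^ n - 0 * H 0%C ^ n)%C with (t * H t ^ n)%C by ring.
          destruct (Ceq_dec t 0) as [-> | Ht0].
            replace (0 * H 0%C ^ n)%C with (RtoC 0) by ring; now rewrite Cmod_0.
          rewrite Cmod_mult, Cmod_pow.
          assert (Cmod (H t) ^ n <= Rabs K ^ n)
            by (apply pow_incr; split; auto using Cmod_ge_0).
          assert (0 <= Cmod (H t) ^ n) by apply pow_le, Cmod_ge_0.
          assert (eps / (Rabs K ^ n + 1) * (Rabs K ^ n + 1) = eps)
            by (field; lra).
          pose proof (Cmod_ge_0 t); nra.
        + apply has_jet_continuous.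
          apply has_jet_mult; [apply has_jet_id |].
          apply has_jet_pow, has_jet_mult; [apply Hjet; lra |].
          apply has_jet_inv; [apply has_jet_pow, has_jet_id |].
          now apply Cpow_nz.
      - intros w Hw Gw.
        assert (Hw0 : w <> 0%C).
          intros ->; apply Gw; unfold G; ring.
        apply has_jet_mult; [apply has_jet_id |].
        apply has_jet_pow, has_jet_mult; [apply Hjet; lra |].
        apply has_jet_inv; [apply has_jet_pow, has_jet_id |].
        now apply Cpow_nz.
      - intros w Hw; unfold G.
        rewrite Cmod_mult, Cmod_pow, Hw.
        apply Rmult_le_compat_l; [lra |].
        apply pow_incr; split; [apply Cmod_ge_0 |].
        assert (Hw0 : w <> 0%C) by (apply Cmod_gt_0; lra).
        unfold H; rewrite Cmod_mult, Cmod_inv, Cmod_pow, Hw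
          by now apply Cpow_nz.
        apply Rmult_le_compat_r; [| apply Hle; lra].
        left; apply Rinv_0_lt_compat, pow_lt; lra.
    unfold G in HG; now rewrite Cmod_mult, Cmod_pow in HG.
  assert (Hr : 0 < r ^ 2) by (apply pow_lt; lra).
  assert (E : Cmod (H z) * r ^ 2 <= 1).
    apply pow_bounded_le_1 with (r / Cmod z); intros n.
    apply (fun H => proj1 (Rle_div_r _ _ _ H)); auto.
    specialize (HH n).
    rewrite Rpow_mult_distr.
    apply Rmult_le_compat_r with (r := (r ^ 2) ^ n) in HH;
      [| apply pow_le; lra].
    apply Rle_trans with (2 := Rle_refl r).
    replace (r * (1 / r ^ 2) ^ n * (r ^ 2) ^ n) with r in HH.
      lra.
    rewrite Rmult_assoc, <- Rpow_mult_distr.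
    replace (1 / r ^ 2 * r ^ 2) with 1 by (field; lra).
    rewrite pow1; ring.
  unfold H in E; rewrite Cmod_mult, Cmod_inv, Cmod_pow in E
    by now apply Cpow_nz.
  assert (0 < Cmod z ^ 2) by now apply pow_lt.
  apply Rmult_le_compat_r with (r := Cmod z ^ 2) in E; [| lra].
  replace (Cmod (F z) * / Cmod z ^ 2 * r ^ 2 * Cmod z ^ 2)
    with (Cmod (F z) * r ^ 2) in E by (field; lra).
  lra.
apply Rle_plus_epsilon; intros eta Heta.
set (d := Rmin (1 - Cmod z) (eta / 2)).
assert (D0 : 0 < d) by (apply Rmin_pos; lra).
assert (D1 : d <= 1 - Cmod z) by apply Rmin_l.
assert (D2 : d <= eta / 2) by apply Rmin_r.
specialize (B (1 - d)); specialize (Hle z Hz).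
pose proof (Cmod_ge_0 (F z)).
assert (Cmod (F z) * (1 - d) ^ 2 <= Cmod z ^ 2) by (apply B; lra).
nra.
Qed.

Lemma schwarz_coefficient (F : C -> C) (A : C) :
  (forall z, Cmod z < 1 -> has_jet F z) ->
  (forall z, Cmod z < 1 -> Cmod (F z) <= 1) ->
  jet F 0 0 0 A ->
  Cmod A <= 1.
Proof.
intros Hjet Hle [e [He HF]].
destruct He as [K [HK He]].
assert (HF' : near0 (fun t => F t = (t ^ 2 * (A + t * e t))%C)).
  apply near0_imp with (2 := HF); intros t Ht.
  replace (0 + t)%C with t in Ht by ring; rewrite Ht; ring.
assert (Hle2 : forall z, Cmod z < 1 -> Cmod (F z) <= Cmod z ^ 2).
  apply schwarz_order_2; auto.
  exists (Cmod A + K).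
  assert (N : near0 (fun t => Cmod t < 1)) by (exists 1; split; auto; lra).
  apply near0_imp with (2 := near0_and _ _ N (near0_and _ _ He HF')).
  intros t [T1 [T2 T3]].
  rewrite T3, Cmod_mult, Cmod_pow, Rmult_comm.
  apply Rmult_le_compat_r; [apply pow_le, Cmod_ge_0 |].
  apply Rle_trans with (1 := Cmod_triangle _ _), Rplus_le_compat_l.
  rewrite Cmod_mult; pose proof (Cmod_ge_0 t); pose proof (Cmod_ge_0 (e t)).
  nra.
apply Rle_plus_epsilon; intros eta Heta.
destruct (near0_and _ _ He HF') as [r [Hr H]].
set (x := Rmin (1 / 2) (Rmin (r / 2) (eta / (K + 1)))).
assert (X0 : 0 < x).
  unfold x; repeat apply Rmin_pos; try lra; apply Rdiv_lt_0_compat; lra.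
assert (X1 : x <= 1 / 2) by apply Rmin_l.
assert (X2 : x <= r / 2) by apply Rle_trans with (1 := Rmin_r _ _), Rmin_l.
assert (X3 : x <= eta / (K + 1))
  by apply Rle_trans with (1 := Rmin_r _ _), Rmin_r.
assert (Hx : Cmod (RtoC x) = x) by (rewrite Cmod_R; apply Rabs_pos_eq; lra).
destruct (H (RtoC x)) as [E1 E2]; [lra |].
assert (E3 : Cmod (F (RtoC x)) <= x ^ 2).
  rewrite <- Hx at 2; apply Hle2; lra.
rewrite E2, Cmod_mult, Cmod_pow, Hx in E3.
assert (E4 : Cmod (A + x * e x)%C <= 1).
  apply Rmult_le_reg_l with (x ^ 2); [apply pow_lt; lra | lra].
pose proof (Cmod_triangle (A + x * e x) (- (x * e x))) as T.
rewrite Cmod_opp, (Cmod_mult x), Hx in T.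
replace (A + x * e x + - (x * e x))%C with A in T by ring.
assert (eta / (K + 1) * (K + 1) = eta) by (field; lra).
pose proof (Cmod_ge_0 (e x)); nra.
Qed.

(** * Coefficients of Schwarz functions *)

Definition schwarz_jet (u : C -> C) (c1 c2 : C) : Prop :=
  (forall z, Cmod z < 1 -> has_jet u z) /\
  (forall z, Cmod z < 1 -> Cmod (u z) < 1) /\
  jet u 0 0 c1 c2.

Lemma schwarz_jet_first (u : C -> C) (c1 c2 : C) :
  schwarz_jet u c1 c2 -> Cmod c1 <= 1.
Proof.
intros (Hj & Hb & H0).
assert (S : Cmod (c1 * c1)%C <= 1).
  apply (schwarz_coefficient (fun z => u z * u z)%C).
  - intros z Hz; apply has_jet_mult; auto.
  - intros z Hz; rewrite Cmod_mult; specialize (Hb z Hz).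
    pose proof (Cmod_ge_0 (u z)); nra.
  - apply (jet_eq_coef _ _ _ _ _ _ _ _ (jet_mult _ _ _ _ _ _ _ _ _ H0 H0));
      ring.
rewrite Cmod_mult in S; pose proof (Cmod_ge_0 c1); nra.
Qed.

(** The first-order terms of [u(z)] and [v(-z)] agree when [d1 = - c1], so half
    their difference is bounded by 1 and has a double zero. *)
Lemma schwarz_jet_diff (u v : C -> C) (c1 c2 d1 d2 : C) :
  schwarz_jet u c1 c2 -> schwarz_jet v d1 d2 -> (c1 + d1)%C = 0%C ->
  Cmod (c2 - d2)%C <= 2.
Proof.
intros (Hju & Hbu & Hu) (Hjv & Hbv & Hv) E.
set (opp := fun z : C => (- (1) * z)%C).
assert (Ho : forall z, jet opp z (- (1) * z) (- (1)) 0).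
  intros z.
  apply (jet_eq_coef _ _ _ _ _ _ _ _
          (jet_mult _ _ _ _ _ _ _ _ _ (jet_const (- (1))%C z) (jet_id z)));
    ring.
assert (Hov : forall z, Cmod z < 1 -> Cmod (opp z) < 1).
  intros z Hz; unfold opp.
  now replace (- (1) * z)%C with (- z)%C by ring; rewrite Cmod_opp.
set (w := fun z => v (opp z)).
assert (Hw : jet w 0 0 (- d1) d2).
  assert (Hv' : jet v (- (1) * 0)%C 0 d1 d2)
    by now replace (- (1) * 0)%C with (RtoC 0) by ring.
  apply (jet_eq_coef _ _ _ _ _ _ _ _ (jet_comp _ _ _ _ _ _ _ _ _ (Ho 0%C) Hv'));
    ring.
assert (S : Cmod (/ 2 * (c2 - d2))%C <= 1).
  apply (schwarz_coefficient (fun z => / 2 * (u z + - (1) * w z))%C).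
  - intros z Hz; apply has_jet_mult; [apply has_jet_const |].
    apply has_jet_plus; auto.
    apply has_jet_mult; [apply has_jet_const |].
    apply (has_jet_comp v opp); [do 3 eexists; apply Ho |]; auto.
  - intros z Hz.
    rewrite Cmod_mult, Cmod_inv, Cmod_R, Rabs_pos_eq
      by (try lra; intros F; apply RtoC_inj in F; lra).
    pose proof (Cmod_triangle (u z) (- (1) * w z)) as T.
    replace (- (1) * w z)%C with (- w z)%C in T |- * by ring.
    rewrite Cmod_opp in T.
    pose proof (Hbu z Hz); pose proof (Hbv _ (Hov z Hz)); unfold w in *; lra.
  - assert (d1 = - c1)%C as ->.
      replace d1 with (c1 + d1 - c1)%C by ring; rewrite E; ring.
    assert (J := jet_mult _ _ _ _ _ _ _ _ _ (jet_const (/ 2)%C 0%C)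
      (jet_plus _ _ _ _ _ _ _ _ _ Hu
        (jet_mult _ _ _ _ _ _ _ _ _ (jet_const (- (1))%C 0%C) Hw))).
    apply (jet_eq_coef _ _ _ _ _ _ _ _ J); ring.
rewrite Cmod_mult, Cmod_inv, Cmod_R, Rabs_pos_eq in S
  by (try lra; intros F; apply RtoC_inj in F; lra).
lra.
Qed.

(** With [a = 1 - u] and [b = 1 - v], the difference of the squared moduli is
    [4 (|a|^2 Re b + |b|^2 Re a - |a|^2 |b|^2)], and [|u| < 1] means
    [|a|^2 < 2 Re a]. *)
Lemma cayley_bound (u v : C) :
  Cmod u < 1 -> Cmod v < 1 ->
  (2 + - (1) * (u + v))%C <> 0%C /\
  Cmod (u + v + - (2) * (u * v))%C <= Cmod (2 + - (1) * (u + v))%C.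
Proof.
intros Hu Hv.
assert (Sq : forall z, Cmod z < 1 -> Re z ^ 2 + Im z ^ 2 < 1).
  intros z Hz; rewrite <- Cmod2_alt; pose proof (Cmod_ge_0 z); nra.
apply Sq in Hu, Hv; destruct u as [x y], v as [s t]; simpl in Hu, Hv.
assert (Hx : x < 1) by nra.
assert (Hs : s < 1) by nra.
split.
- intros E; apply (f_equal fst) in E; simpl in E; lra.
- apply Rsqr_incr_0; try apply Cmod_ge_0.
  rewrite !Rsqr_pow2, !Cmod2_alt; unfold Re, Im; simpl.
  set (a := 1 - x); set (b := 1 - s).
  assert (Ha : a ^ 2 + y ^ 2 <= 2 * a) by (unfold a; nra).
  assert (Hb : b ^ 2 + t ^ 2 <= 2 * b) by (unfold b; nra).
  assert (P : 0 <= (a ^ 2 + y ^ 2) * (2 * b - (b ^ 2 + t ^ 2))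
                 + (b ^ 2 + t ^ 2) * (2 * a - (a ^ 2 + y ^ 2))).
    apply Rplus_le_le_0_compat; apply Rmult_le_pos; nra.
  replace x with (1 - a) by (unfold a; ring).
  replace s with (1 - b) by (unfold b; ring).
  nra.
Qed.

(** When [d1 = - c1] the numerator of the Cayley transform
    [(u + v - 2 u v) / (2 - u - v)] has a double zero, with leading coefficient
    [c2 + d2 + 2 c1^2], while the denominator is 2 at 0. *)
Lemma schwarz_jet_sum (u v : C -> C) (c1 c2 d1 d2 : C) :
  schwarz_jet u c1 c2 -> schwarz_jet v d1 d2 -> (c1 + d1)%C = 0%C ->
  Cmod ((c2 + d2) / 2 + c1 ^ 2)%C <= 1.
Proof.
intros (Hju & Hbu & Hu) (Hjv & Hbv & Hv) E.
set (N := fun z => (u z + v z + - (2) * (u z * v z))%C).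
set (Dn := fun z => (2 + - (1) * (u z + v z))%C).
assert (two : RtoC 2 <> 0%C) by (intros F; apply RtoC_inj in F; lra).
assert (Ed : d1 = (- c1)%C).
  replace d1 with (c1 + d1 - c1)%C by ring; rewrite E; ring.
subst d1.
assert (JN : jet N 0 0 0 (c2 + d2 + 2 * c1 ^ 2)).
  assert (J := jet_plus _ _ _ _ _ _ _ _ _
    (jet_plus _ _ _ _ _ _ _ _ _ Hu Hv)
    (jet_mult _ _ _ _ _ _ _ _ _ (jet_const (- (2))%C 0%C)
       (jet_mult _ _ _ _ _ _ _ _ _ Hu Hv))).
  apply (jet_eq_coef _ _ _ _ _ _ _ _ J); ring.
assert (JD : jet Dn 0 2 0 (- (c2 + d2))).
  assert (J := jet_plus _ _ _ _ _ _ _ _ _ (jet_const 2 0%C)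
    (jet_mult _ _ _ _ _ _ _ _ _ (jet_const (- (1))%C 0%C)
       (jet_plus _ _ _ _ _ _ _ _ _ Hu Hv))).
  apply (jet_eq_coef _ _ _ _ _ _ _ _ J); ring.
apply (schwarz_coefficient (fun z => N z * / Dn z)%C).
- intros z Hz.
  apply has_jet_mult; [| apply has_jet_inv].
  + repeat apply has_jet_plus; auto.
    apply has_jet_mult; [apply has_jet_const | apply has_jet_mult]; auto.
  + apply has_jet_plus; [apply has_jet_const |].
    apply has_jet_mult; [apply has_jet_const | apply has_jet_plus]; auto.
  + apply (cayley_bound (u z) (v z)); auto.
- intros z Hz.
  destruct (cayley_bound (u z) (v z) (Hbu z Hz) (Hbv z Hz)) as [H1 H2].
  unfold N, Dn; rewrite Cmod_mult, Cmod_inv by auto.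
  apply Cmod_gt_0 in H1.
  apply (fun H => proj2 (Rle_div_l _ _ _ H)); lra.
- assert (J := jet_mult _ _ _ _ _ _ _ _ _ JN
    (jet_comp _ _ _ _ _ _ _ _ _ JD (jet_inv 2 two))).
  apply (jet_eq_coef _ _ _ _ _ _ _ _ J); field; auto.
Qed.

(** * Coefficients in the class *)

Lemma near0_disc : near0 (fun z => Defs.disc z).
Proof. exists 1; split; [lra | auto]. Qed.

Lemma expansion_near0 (F : C -> C) (c : nat -> C) :
  expansion_on_disc F c -> near0 (fun z => is_pseries c z (F z)).
Proof. intros H; exact (near0_imp _ _ H near0_disc). Qed.

Lemma subordinate_coefficients (H phi : C -> C) (B : nat -> C) (h0 h1 h2 : C) :
  subordinate H phi -> expansion_on_disc phi B -> jet H 0 h0 h1 h2 ->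
  exists u c1 c2, schwarz_jet u c1 c2 /\
    h1 = (B 1%nat * c1)%C /\ h2 = (B 1%nat * c2 + B 2%nat * c1 ^ 2)%C.
Proof.
intros (u & Hu & Hu0 & Hsub) HB HH.
assert (Hj : forall z, Cmod z < 1 -> has_jet u z).
  intros z; exact (analytic_has_jet _ _ z Hu).
destruct (Hj 0%C) as (c0 & c1 & c2 & H0); [rewrite Cmod_0; lra |].
assert (c0 = 0%C) as -> by now rewrite <- (jet_value _ _ _ _ _ H0).
exists u, c1, c2; split.
  split; [| split]; auto; intros z Hz; now apply Hsub.
assert (J := jet_comp _ _ _ _ _ _ _ _ _ H0
  (expansion_jet _ _ (expansion_near0 _ _ HB))).
assert (J' : jet (fun z => phi (u z)) 0 h0 h1 h2).
  apply jet_ext with (2 := HH); apply near0_imp with (2 := near0_disc).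
  intros t Ht; replace (0 + t)%C with t by ring; now apply Hsub.
destruct (jet_unique _ _ _ _ _ _ _ _ J' J) as (_ & E1 & E2); auto.
Qed.

Lemma normalized_quotient_jet (h : C -> C) (c : nat -> C) :
  normalized_expansion h c ->
  jet (difference_quotient h 1) 0 1 (c 2%nat) (c 3%nat).
Proof.
intros (E0 & E1 & Hc); rewrite <- E1.
apply (expansion_jet _ (PS_decr_1 c)).
apply near0_imp with (2 := expansion_near0 _ _ Hc); intros z Hz.
now apply pseries_quotient.
Qed.

Lemma normalized_jet (h : C -> C) (c : nat -> C) :
  normalized_expansion h c -> jet h 0 0 1 (c 2%nat).
Proof.
intros (E0 & E1 & Hc).
assert (J := expansion_jet _ _ (expansion_near0 _ _ Hc)).
apply (jet_eq_coef _ _ _ _ _ _ _ _ J); auto.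
Qed.

Lemma normalized_expansion_unique (h : C -> C) (c d : nat -> C) :
  normalized_expansion h c -> normalized_expansion h d ->
  c 2%nat = d 2%nat /\ c 3%nat = d 3%nat.
Proof.
intros Hc Hd.
destruct (jet_unique _ _ _ _ _ _ _ _ (normalized_quotient_jet _ _ Hc)
  (normalized_quotient_jet _ _ Hd)) as (_ & E2 & E3); auto.
Qed.

(** Writing [f z = z F z] and [g w = w G w], the relation [f (g w) = w] becomes
    [G w F(g w) = 1]; expanding to second order in this form determines
    the third coefficients. *)
Lemma inverse_coefficients (f g : C -> C) (a b : nat -> C) :
  normalized_expansion f a -> normalized_expansion g b -> local_inverse f g ->
  b 2%nat = (- a 2%nat)%C /\ b 3%nat = (2 * a 2%nat ^ 2 - a 3%nat)%C.
Proof.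
intros Ha Hb (r & Hr & Hinv).
assert (Jf := normalized_quotient_jet _ _ Ha).
assert (Jg := normalized_quotient_jet _ _ Hb).
assert (Jg' := normalized_jet _ _ Hb).
assert (Hf0 : f 0%C = 0%C)
  by exact (jet_value _ _ _ _ _ (normalized_jet _ _ Ha)).
assert (Hg0 : g 0%C = 0%C) by exact (jet_value _ _ _ _ _ Jg').
assert (J := jet_mult _ _ _ _ _ _ _ _ _ Jg
  (jet_comp _ _ _ _ _ _ _ _ _ Jg' Jf)).
assert (J1 : jet (fun w => difference_quotient g 1 w
                           * difference_quotient f 1 (g w))%C 0 1 0 0).
  apply jet_ext with (2 := jet_const 1 0%C).
  exists r; split; auto; intros t Ht; replace (0 + t)%C with t by ring.
  destruct (Hinv t Ht) as [_ E].
  unfold difference_quotient.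
  destruct (Ceq_dec t 0) as [-> | Ht0].
    rewrite Hg0; destruct (Ceq_dec 0 0) as [_ | N]; [ring | now elim N].
  (* [g t = 0] would give [t = f (g t) = f 0 = 0]. *)
  destruct (Ceq_dec (g t) 0) as [Eg | Hg].
    elim Ht0; rewrite <- E, Eg; exact Hf0.
  rewrite E; field; auto.
destruct (jet_unique _ _ _ _ _ _ _ _ J1 J) as (_ & E1 & E2).
assert (E2' : b 2%nat = (- a 2%nat)%C).
  transitivity (1 * (a 2%nat * 1) + b 2%nat * 1 - a 2%nat)%C; [ring |].
  rewrite <- E1; ring.
split; auto.
rewrite E2' in E2.
transitivity (1 * (a 2%nat * - a 2%nat + a 3%nat * 1 ^ 2)
  + - a 2%nat * (a 2%nat * 1) + b 3%nat * 1
  + (2 * a 2%nat ^ 2 - a 3%nat))%C; [ring |].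
rewrite <- E2; ring.
Qed.

Lemma qnum_1 (q : R) : 0 < q < 1 -> qnum q 1 = 1.
Proof. intros Hq; unfold qnum; field; lra. Qed.

Lemma qnum_pos (q : R) (n : nat) : 0 < q < 1 -> 0 < qnum q (S n).
Proof.
intros Hq; unfold qnum; apply Rdiv_lt_0_compat; [| lra].
assert (q ^ S n < 1); [| lra].
assert (q ^ n <= 1) by (rewrite <- (pow1 n); apply pow_incr; lra).
simpl; nra.
Qed.

(** The [n]-th coefficient of [H z / z] is the [(n+1)]-st one of [H], and it is
    multiplied by [n + 1] in the derivative; the weights [1 - mu] and [mu]
    combine these to [(1 - mu) + mu (n + 1) = 1 + n mu]. *)
Lemma salagean_transform_jet (q mu : R) (k : nat) (h Dh : C -> C)
    (c : nat -> C) :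
  0 < q < 1 -> salagean q k h Dh -> normalized_expansion h c ->
  jet (mu_transform mu Dh) 0 1
    (RtoC ((1 + mu) * qnum q 2 ^ k) * c 2%nat)
    (RtoC ((1 + 2 * mu) * qnum q 3 ^ k) * c 3%nat).
Proof.
intros Hq (c' & Hc' & HD) Hc.
destruct (normalized_expansion_unique _ _ _ Hc Hc') as [-> ->].
set (d := fun n => (RtoC (qnum q n ^ k) * c' n)%C) in *.
assert (Hd : normalized_expansion Dh d).
  destruct Hc' as (E0 & E1 & _).
  split; [| split]; auto; unfold d.
  - rewrite E0; ring.
  - rewrite E1, (qnum_1 q Hq), pow1; ring.
assert (J1 := normalized_quotient_jet _ _ Hd).
assert (J2 := expansion_jet _ _
  (pseries_derive _ _ (expansion_near0 _ _ HD))).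
assert (J := jet_plus _ _ _ _ _ _ _ _ _
  (jet_mult _ _ _ _ _ _ _ _ _ (jet_const (RtoC (1 - mu)) 0%C) J1)
  (jet_mult _ _ _ _ _ _ _ _ _ (jet_const (RtoC mu) 0%C) J2)).
destruct Hd as (_ & Hd1 & _).
apply (jet_eq_coef _ _ _ _ _ _ _ _ J).
- rewrite Hd1; simpl INR; rewrite RtoC_minus; ring.
- unfold d; cbv beta; simpl INR;
  repeat rewrite ?RtoC_mult, ?RtoC_minus, ?RtoC_plus; ring.
- unfold d; cbv beta; simpl INR;
  repeat rewrite ?RtoC_mult, ?RtoC_minus, ?RtoC_plus; ring.
Qed.

Theorem theorem3p4 (q : R) (k : nat) (mu : R) (phi : C -> C)
    (B : nat -> C) (B1 : R) (f : C -> C) (a : nat -> C)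
    (hq : 0 < q < 1) (hmu : 0 <= mu <= 1)
    (hphi : ma_minda phi)
    (hB : expansion_on_disc phi B)
    (hB1 : B 1%nat = RtoC B1) (hB1_pos : 0 < B1)
    (hf : class_FSigma q k mu phi f)
    (ha : normalized_expansion f a) :
  let D := Cmod (RtoC ((1 + 2 * mu) * qnum q 3 ^ k * B1 ^ 2)
                 + RtoC ((1 + mu) ^ 2 * qnum q 2 ^ (2 * k))
                   * (RtoC B1 - B 2%nat))%C in
  (D <> 0 -> Cmod (a 2%nat) <= B1 * sqrt B1 / sqrt D) /\
  Cmod (a 3%nat) <=
    B1 * (B1 / ((1 + mu) ^ 2 * qnum q 2 ^ (2 * k))
          + 1 / ((1 + 2 * mu) * qnum q 3 ^ k)).
Proof.
destruct hf as (g & Df & Dg & (_ & _ & _ & Hinv) & Sf & Sg & subf & subg).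
destruct (Sg) as (b & Hb & _).
destruct (inverse_coefficients _ _ _ _ ha Hb Hinv) as [Eb2 Eb3].
assert (Jf := salagean_transform_jet q mu k f Df a hq Sf ha).
assert (Jg := salagean_transform_jet q mu k g Dg b hq Sg Hb).
set (s := (1 + mu) * qnum q 2 ^ k) in *.
set (P := (1 + 2 * mu) * qnum q 3 ^ k) in *.
assert (Hs : 0 < s).
  apply Rmult_lt_0_compat; [lra | apply pow_lt, qnum_pos, hq].
assert (HP : 0 < P).
  apply Rmult_lt_0_compat; [lra | apply pow_lt, qnum_pos, hq].
assert (EQ : (1 + mu) ^ 2 * qnum q 2 ^ (2 * k) = s ^ 2).
  unfold s; rewrite (Nat.mul_comm 2 k), pow_mult; ring.
rewrite EQ.
destruct (subordinate_coefficients _ _ _ _ _ _ subf hB Jf)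
  as (u & c1 & c2 & Hu & U1 & U2).
destruct (subordinate_coefficients _ _ _ _ _ _ subg hB Jg)
  as (v & d1 & d2 & Hv & V1 & V2).
rewrite hB1 in *; rewrite Eb2 in V1; rewrite Eb3 in V2.
set (a2 := a 2%nat) in *; set (a3 := a 3%nat) in *; set (B2 := B 2%nat) in *.
assert (nz : forall x : R, 0 < x -> RtoC x <> 0%C).
  intros x Hx F; apply RtoC_inj in F; lra.
assert (Hcd : (c1 + d1)%C = 0%C).
  transitivity ((RtoC B1 * c1 + RtoC B1 * d1) / RtoC B1)%C.
    field; auto.
  rewrite <- U1, <- V1; field; auto.
assert (Ed : d1 = (- c1)%C).
  replace d1 with (c1 + d1 - c1)%C by ring; rewrite Hcd; ring.
assert (Ba := schwarz_jet_first _ _ _ Hu).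
assert (Bd := schwarz_jet_diff _ _ _ _ _ _ Hu Hv Hcd).
assert (Bs := schwarz_jet_sum _ _ _ _ _ _ Hu Hv Hcd).
rewrite Ed in V2.
assert (Ea2 : a2 = (RtoC B1 * c1 / RtoC s)%C).
  rewrite <- U1; field; auto.
intros D; split.
- intros HD.
  assert (HD0 : 0 < D).
    pose proof (Cmod_ge_0 (RtoC (P * B1 ^ 2) + RtoC (s ^ 2) * (RtoC B1 - B2))).
    fold D in H; lra.
  (* Adding the two equations for [a3] leaves [B2 c1^2], which
     [s a2 = B1 c1] turns into a multiple of [a2^2]. *)
  assert (E : (a2 ^ 2 * (RtoC (P * B1 ^ 2) + RtoC (s ^ 2) * (RtoC B1 - B2))
    = RtoC B1 ^ 3 * ((c2 + d2) / 2 + c1 ^ 2))%C).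
    transitivity (RtoC B1 ^ 2
        * ((RtoC P * a3 + RtoC P * (2 * a2 ^ 2 - a3)) / 2)
      + (RtoC s * a2) ^ 2 * (RtoC B1 - B2))%C.
      rewrite RtoC_mult, !RtoC_pow; field; auto using Rlt_0_2.
    rewrite U1, U2, V2; field; auto using Rlt_0_2.
  apply (f_equal Cmod) in E.
  rewrite !Cmod_mult, !Cmod_pow, Cmod_R, (Rabs_pos_eq B1) in E by lra.
  fold D in E.
  assert (Main : Cmod a2 ^ 2 * D <= B1 ^ 3).
    rewrite E; pose proof (pow_lt B1 3 hB1_pos); nra.
  apply (fun H => proj1 (Rle_div_r _ _ _ H)); [now apply sqrt_lt_R0 |].
  apply Rsqr_incr_0.
  + rewrite !Rsqr_mult, !Rsqr_sqrt by lra; unfold Rsqr.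
    simpl in Main; lra.
  + apply Rmult_le_pos; [apply Cmod_ge_0 | apply sqrt_pos].
  + apply Rmult_le_pos; [lra | apply sqrt_pos].
(* Subtracting the two equations for [a3] eliminates [B2], as [d1^2 = c1^2]. *)
- assert (E : a3 = (a2 ^ 2 + RtoC B1 * (c2 - d2) / (2 * RtoC P))%C).
    transitivity (a2 ^ 2
      + (RtoC P * a3 - RtoC P * (2 * a2 ^ 2 - a3)) / (2 * RtoC P))%C.
      field; auto using Rlt_0_2.
    rewrite U2, V2; field; auto using Rlt_0_2.
  rewrite E; apply Rle_trans with (1 := Cmod_triangle _ _).
  replace (B1 * (B1 / s ^ 2 + 1 / P)) with ((B1 / s) ^ 2 + B1 * 2 / (2 * P))
    by (field; lra).
  apply Rplus_le_compat.
  + rewrite Cmod_pow; apply pow_incr; split; [apply Cmod_ge_0 |].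
    rewrite Ea2, Cmod_div, Cmod_mult, !Cmod_R, !Rabs_pos_eq by (auto; lra).
    apply Rmult_le_compat_r; [left; now apply Rinv_0_lt_compat | nra].
  + rewrite <- RtoC_mult, Cmod_div, Cmod_mult, !Cmod_R, !Rabs_pos_eq
      by (try apply nz; lra).
    apply Rmult_le_compat_r; [left; apply Rinv_0_lt_compat; lra |].
    apply Rmult_le_compat_l; lra.
Qed.
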